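(* Let $\mathcal{P}\subset\mathbb{R}^d$ be a convex and compact polytope with Euclidean diameter $D$ and vertex set $\mathcal{V}$. Let $f,\tilde f:\mathbb{R}^d\to\mathbb{R}$ be two $\beta$-smooth convex functions that both have quadratic growth with parameter $\alpha>0$ over $\mathcal{P}$. Suppose that $\|\nabla f(x)-\nabla\tilde f(x)\|\le\nu$ for all $x\in\mathcal{P}$. Let $\mathcal{F}^*$ and $\tilde{\mathcal{F}}^*$ be the optimal faces of $\mathcal{P}$ with respect to the objective functions $f$ and $\tilde f$, respectively, and suppose the strict complementarity condition holds with respect to the function $f$ and the face $\mathcal{F}^*$ with parameter $\delta>0$. If $$\nu<\frac{\delta}{D(1+2\beta/\alpha)},$$ then $\tilde{\mathcal{F}}^*\subseteq\mathcal{F}^*$.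
   Context: $\|\cdot\|$ is the Euclidean norm. A function is $\beta$-smooth if it is differentiable with $\beta$-Lipschitz gradient. For an objective $g$ on $\mathcal{P}$, let $g^*=\min_{x\in\mathcal{P}}g(x)$ and let $\mathcal{X}^*_g\subseteq\mathcal{P}$ be its set of minimizers over $\mathcal{P}$. The optimal face with respect to $g$ is the lowest-dimensional face of $\mathcal{P}$ containing $\mathcal{X}^*_g$ ($\mathcal{P}$ itself counts as a face). Quadratic growth with parameter $\alpha>0$ over $\mathcal{P}$: for all $x\in\mathcal{P}$, $\mathrm{dist}(x,\mathcal{X}^*_g)^2\le\frac{2}{\alpha}(g(x)-g^* )$, where $\mathrm{dist}(x,W)=\inf_{y\in W}\|y-x\|$. Strict complementarity with respect to $f$ and $\mathcal{F}^*$ with parameter $\delta>0$: for all $x^*\in\mathcal{X}^*_f$ and $v\in\mathcal{V}$, if $v\in\mathcal{V}\setminus\mathcal{F}^*$ then $(v-x^* )^{\top}\nabla f(x^* )\ge\delta$, and if $v\in\mathcal{V}\cap\mathcal{F}^*$ then $(v-x^* )^{\top}\nabla f(x^* )=0$. *)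

(* Defs.v *)
From mathcomp Require Import all_boot all_order all_algebra.
From mathcomp Require Import all_classical all_reals all_analysis.

Set Implicit Arguments.
Unset Strict Implicit.
Unset Printing Implicit Defensive.

Import Order.TTheory GRing.Theory Num.Theory.
Import numFieldNormedType.Exports.

Local Open Scope classical_set_scope.
Local Open Scope ring_scope.

Section Euclidean.
Context {R : realType} {d : nat}.
Implicit Types (u v x y : 'rV[R]_d) (A P W F : set 'rV[R]_d) (g : 'rV[R]_d -> R).

Definition dot u v : R := (u *m v^T) 0 0.

(* The library norm `|u| on 'rV[R]_d is the sup norm. *)
Definition enorm u : R := Num.sqrt (dot u u).

Definition dist x W : R := inf [set enorm (y - x) | y in W].

Definition diameter A : R := sup [set enorm (z.1 - z.2) | z in A `*` A].

(* The row of partial derivatives. *)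
Definition grad g x : 'rV[R]_d := \row_(i < d) 'D_(delta_mx 0 i) g x.

(* Differentiability is taken for the sup norm, which is equivalent to the
   Euclidean one; the Lipschitz condition is Euclidean. *)
Definition smooth (beta : R) g :=
  (forall x, differentiable g x) /\
  (forall x y, enorm (grad g x - grad g y) <= beta * enorm (x - y)).

Definition convex_hull (s : seq 'rV[R]_d) : set 'rV[R]_d :=
  [set x | exists w : 'I_(size s) -> R,
    [/\ forall i, 0 <= w i, \sum_i w i = 1 & x = \sum_i w i *: s`_i]].

Definition polytope P := exists s : seq 'rV[R]_d, P = convex_hull s.

(* The sets cut out by a valid inequality <c, x> <= b. With c = 0 and b = 0
   this gives P itself. *)
Definition face P F := exists (c : 'rV[R]_d) (b : R),
  (forall x, P x -> dot c x <= b) /\ F = [set x | P x /\ dot c x = b].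

Definition vertices P : set 'rV[R]_d := [set v | face P [set v]].

(* The largest k such that A contains k + 1 affinely independent points x0,
   x0 + row i M (i < k); it is 0 when A is empty. *)
Definition affine_dim A : nat :=
  \max_(k < d.+1 | `[< exists (x0 : 'rV[R]_d) (M : 'M[R]_(k, d)),
      [/\ A x0, forall i, A (x0 + row i M) & row_free M] >]) k.

Definition minimizers P g : set 'rV[R]_d :=
  [set x | P x /\ forall y, P y -> g x <= g y].

(* The infimum is attained when P is nonempty and compact and g continuous. *)
Definition minval P g : R := inf (g @` P).

Definition optimal_face P g F :=
  [/\ face P F, minimizers P g `<=` F &
      forall G, face P G -> minimizers P g `<=` G ->
        (affine_dim F <= affine_dim G)%N].

Definition quadratic_growth (alpha : R) P g :=
  forall x, P x ->
    dist x (minimizers P g) ^+ 2 <= 2 / alpha * (g x - minval P g).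

Definition strict_complementarity (delta : R) P g F :=
  forall x v, minimizers P g x -> vertices P v ->
    (~ F v -> delta <= dot (v - x) (grad g x)) /\
    (F v -> dot (v - x) (grad g x) = 0).

End Euclidean.

(* Main.v *)
Require Import Defs.
From mathcomp Require Import all_boot all_order all_algebra.
From mathcomp Require Import all_classical all_reals all_analysis.
From mathcomp Require Import ring lra.

Import Order.TTheory GRing.Theory Num.Theory.
Import numFieldNormedType.Exports.

Local Open Scope classical_set_scope.
Local Open Scope ring_scope.

(** Let x be a minimizer of ft over P and write q for its gradient there.

    The minimizer x is close to the minimizers of f. By convexity of f and
    first-order optimality of x for ft, f x - f y <= nu * |x - y| for every
    minimizer y of f; quadratic growth of f turns this into a distance of at
    most 2 nu / alpha ([growth_near_minimizer]).

    Now take a vertex v outside F and a minimizer y of f near x. Replacing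
    grad f y by q changes <v - y, grad f y> >= delta by at most
    D (nu + beta * 2 nu / alpha), the first term coming from the closeness of
    the two gradients and the second from smoothness of f. This is where the
    bound on nu is used: what remains is positive. Since <y - x, q> >= 0 by
    optimality of x, <v - x, q> > 0 ([vertex_gap]). The detour through y
    matters: <x - y, grad f y> has no useful upper bound, so x and y must not
    be exchanged before passing to q.

    The points of P where q attains its minimum form a face Z through x, and
    no vertex outside F lies on Z. A face all of whose vertices lie in another
    face is contained in it ([face_sub_of_vertices]), so Z is contained in F
    and x lies in F. Thus F is a face containing all minimizers of ft. A face
    of least dimension with that property is contained in any other one,
    because intersecting it with a face that does not contain it would lower
    its dimension ([optimal_face_sub]).

    Vertices and faces are exposed ones, given by valid inequalities. What is
    needed about them, beyond intersecting two faces, rests on [face_argmax]: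
    an exposed face of an exposed face of a polytope is again exposed.

    Dividing by D (1 + 2 beta / alpha) needs this number to be positive. If
    some point of Ft is not in F, it differs from a minimizer of f, and these
    two points show 0 < D and 0 <= beta. *)

(** * The Euclidean inner product *)

Section Dot.
Context {R : realType} {d : nat}.
Implicit Types u v w x : 'rV[R]_d.

Lemma dotE u v : dot u v = \sum_i u 0 i * v 0 i.
Proof. by rewrite /dot mxE; apply: eq_bigr => i _; rewrite mxE. Qed.

Lemma dotC u v : dot u v = dot v u.
Proof. by rewrite !dotE; apply: eq_bigr => i _; rewrite mulrC. Qed.

Lemma dotDl u v w : dot (u + v) w = dot u w + dot v w.
Proof. by rewrite /dot mulmxDl mxE. Qed.

Lemma dotZl a u v : dot (a *: u) v = a * dot u v.
Proof. by rewrite /dot -scalemxAl mxE. Qed.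

Lemma dotNl u v : dot (- u) v = - dot u v.
Proof. by rewrite /dot mulNmx mxE. Qed.

Lemma dotDr u v w : dot u (v + w) = dot u v + dot u w.
Proof. by rewrite dotC dotDl !(dotC u). Qed.

Lemma dotZr a u v : dot u (a *: v) = a * dot u v.
Proof. by rewrite dotC dotZl dotC. Qed.

Lemma dotNr u v : dot u (- v) = - dot u v.
Proof. by rewrite dotC dotNl dotC. Qed.

Definition dot_expand := (dotDl, dotDr, dotNl, dotNr).

Lemma dot0r u : dot u 0 = 0.
Proof. by rewrite -(scale0r u) dotZr mul0r. Qed.

Lemma dot_sumr (I : finType) u (F : I -> 'rV[R]_d) :
  dot u (\sum_i F i) = \sum_i dot u (F i).
Proof. by elim/big_rec2: _ => [|i y1 y2 _ <-]; rewrite ?dot0r ?dotDr. Qed.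

Lemma dot_delta i u : dot (delta_mx 0 i) u = u 0 i.
Proof.
rewrite dotE (bigD1 i)//= mxE !eqxx mul1r big1 ?addr0// => j ji.
by rewrite mxE (negPf ji) andbF mul0r.
Qed.

Lemma dot_ge0 u : 0 <= dot u u.
Proof. by rewrite dotE sumr_ge0// => i _; rewrite -expr2 sqr_ge0. Qed.

Lemma dot_eq0 u : dot u u = 0 -> u = 0.
Proof.
rewrite dotE => /eqP; rewrite psumr_eq0 => [/allP u0|i _]; last first.
  by rewrite -expr2 sqr_ge0.
apply/rowP => i; rewrite mxE; have := u0 i (mem_index_enum _).
by rewrite /= -expr2 sqrf_eq0 => /eqP.
Qed.

Lemma enorm_ge0 u : 0 <= enorm u.
Proof. exact: sqrtr_ge0. Qed.

Lemma enorm_sqr u : enorm u ^+ 2 = dot u u.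
Proof. by rewrite sqr_sqrtr ?dot_ge0. Qed.

Lemma enorm_eq0 u : enorm u = 0 -> u = 0.
Proof. by move=> u0; apply: dot_eq0; rewrite -enorm_sqr u0 expr0n. Qed.

Lemma enormC u v : enorm (u - v) = enorm (v - u).
Proof. by rewrite -(opprB v u) /enorm dotNl dotNr opprK. Qed.

(** Expand the square of [|v| u - |u| v]. *)
Lemma cauchy_schwarz u v : dot u v <= enorm u * enorm v.
Proof.
set a := enorm u; set b := enorm v.
have [a0 b0] : 0 <= a /\ 0 <= b by split; exact: enorm_ge0.
have [/eqP|ab0] := eqVneq (a * b) 0.
  rewrite mulf_eq0 => /orP[] /eqP /enorm_eq0 e0.
    by rewrite e0 dotC dot0r mulr_ge0.
  by rewrite e0 dot0r mulr_ge0.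
have abgt : 0 < a * b by rewrite lt_def ab0 mulr_ge0.
have := dot_ge0 (b *: u - a *: v).
rewrite !dot_expand !(dotZl, dotZr) (dotC v u) -!enorm_sqr -/a -/b => h.
by rewrite -(ler_pM2l abgt); nra.
Qed.

Lemma dot_ge_Nenorm u v : - (enorm u * enorm v) <= dot u v.
Proof.
rewrite lerNl -dotNl (le_trans (cauchy_schwarz _ _))//.
by rewrite /enorm dotNl dotNr opprK.
Qed.
End Dot.

(** * Polytopes, faces and vertices *)

Section Hull.
Context {R : realType} {d : nat}.
Implicit Types (c x y : 'rV[R]_d) (s : seq 'rV[R]_d) (G : set 'rV[R]_d).

(** A linear functional on a polytope is controlled by its values on the
    generators; every other bound on a polytope is deduced from this one. *)
Lemma hull_le s c b : (forall i : 'I_(size s), dot c s`_i <= b) ->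
  forall x, convex_hull s x -> dot c x <= b.
Proof.
move=> sb x [w [w0 w1 ->]]; rewrite dot_sumr -[b]mul1r -w1 mulr_suml.
by apply: ler_sum => i _; rewrite dotZr ler_wpM2l.
Qed.

Lemma hull_mem s (i : 'I_(size s)) : convex_hull s s`_i.
Proof.
exists (fun j => (j == i)%:R); split => [j||]; first exact: ler0n.
  by rewrite (bigD1 i)//= eqxx big1 ?addr0// => j /negPf ->.
rewrite (bigD1 i)//= eqxx scale1r big1 ?addr0// => j /negPf ->.
by rewrite scale0r.
Qed.

Lemma hull_convex s t x y : 0 <= t <= 1 ->
  convex_hull s x -> convex_hull s y -> convex_hull s (x + t *: (y - x)).
Proof.
move=> /andP[t0 t1] [u [u0 u1 ->]] [v [v0 v1 ->]].
exists (fun i => (1 - t) * u i + t * v i); split.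
- by move=> i; rewrite addr_ge0 ?mulr_ge0 ?subr_ge0.
- by rewrite big_split/= -!mulr_sumr u1 v1 !mulr1 subrK.
- rewrite -sumrB scaler_sumr -big_split/=; apply: eq_bigr => i _.
  by apply/rowP => k; rewrite !mxE; ring.
Qed.

(** Applying [hull_le] in each argument of [dot] bounds it on the polytope by
    its values on pairs of generators. The sign [e] gives both signs at once. *)
Lemma hull_bounded s : exists B, forall x y,
  convex_hull s x -> convex_hull s y -> enorm (x - y) <= B.
Proof.
pose B := \sum_(i < size s) \sum_(j < size s) `|dot s`_i s`_j|.
have B0 : 0 <= B by apply: sumr_ge0 => i _; apply: sumr_ge0.
have leB (i j : 'I_(size s)) : `|dot s`_i s`_j| <= B.
  rewrite /B (bigD1 i)//= (bigD1 j)//= -addrA lerDl addr_ge0//.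
    exact: sumr_ge0.
  by apply: sumr_ge0 => k _; apply: sumr_ge0.
have leB1 (e : bool) x y : convex_hull s x -> convex_hull s y ->
    (-1) ^+ e * dot x y <= B.
  move=> hx hy; rewrite -dotZl; apply: hull_le (y) hy => i.
  rewrite dotZl dotC -dotZl; apply: hull_le (x) hx => j.
  rewrite dotZl (le_trans _ (leB i j))// (le_trans (ler_norm _))//.
  by rewrite normrMsign.
exists (Num.sqrt (4 * B)) => x y hx hy; apply: ler_wsqrtr.
have := leB1 false _ _ hx hx; have := leB1 false _ _ hy hy.
have := leB1 true _ _ hx hy.
rewrite expr1 expr0 !mul1r mulN1r !dot_expand (dotC y x); lra.
Qed.

Lemma face_sub P G : face P G -> G `<=` P.
Proof. by move=> [c [b [_ ->]]] x []. Qed.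

Lemma faceI P G H : face P G -> face P H -> face P (G `&` H).
Proof.
move=> [a [p [aP ->]]] [c [q [cP ->]]]; exists (a + c), (p + q); split.
  by move=> x Px; rewrite dotDl lerD ?aP ?cP.
apply/seteqP; split => x /=.
  by move=> [[Px ax] [_ cx]]; rewrite dotDl ax cx.
move=> [Px]; have := aP x Px; have := cP x Px; rewrite dotDl => h1 h2 h3.
by do !split => //; lra.
Qed.

(** If [G] is cut out by [a], then the points of [G] where [c] is maximal are
    cut out by [c + (t + 1) *: a] for [t] large: a generator off [G] has a
    positive slack for [a], and a large multiple of this slack outweighs
    whatever the generator gains in [c]. *)
Lemma face_argmax s G c : face (convex_hull s) G -> G !=set0 ->
  exists M, [/\ face (convex_hull s) [set x | G x /\ dot c x = M],
    [set x | G x /\ dot c x = M] !=set0 & forall x, G x -> dot c x <= M].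
Proof.
move=> [a [b [aP GE]]] [x0 Gx0].
(* Otherwise the largest value of a on the generators would be below b. *)
have [i0 i0b] : exists i : 'I_(size s), dot a s`_i == b.
  apply/existsP; apply: contraT; rewrite negb_exists => /forallP sb.
  have slt (i : 'I_(size s)) : dot a s`_i < b.
    by rewrite lt_def eq_sym sb aP//; exact: hull_mem.
  move: Gx0; rewrite GE => -[hx0 ax0].
  case: (hx0) => w [w0 w1 _].
  have [i0] : exists i : 'I_(size s), true.
    case: (pickP (fun i : 'I_(size s) => true)) => [i _|nos]; first by exists i.
    by move/eqP: w1; rewrite big_pred0 // eq_sym oner_eq0.
  move=> _; pose k := [arg max_(i > i0) dot a s`_i]%O.
  have : dot a x0 <= dot a s`_k.
    apply: hull_le hx0 => i; rewrite /k; case: arg_maxP => // j _; exact.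
  by rewrite ax0 leNgt slt.
pose k := [arg max_(i > i0 | dot a (s`_(i : 'I_(size s))) == b) dot c s`_i]%O.
have [kb kmax] : dot a s`_k = b /\
    forall i : 'I_(size s), dot a s`_i == b -> dot c s`_i <= dot c s`_k.
  by rewrite /k; case: arg_maxP => // j /eqP.
set M := dot c s`_k in kmax.
(* A crude upper bound for all the ratios of gain to slack; for a
   generator in G the denominator is 0, and so is the term. *)
pose t := \sum_(i < size s) `|(dot c s`_i - M) / (b - dot a s`_i)|.
have tP x : convex_hull s x -> dot (c + t *: a) x <= M + t * b.
  apply: hull_le => i; rewrite dotDl dotZl.
  have [ib|ib] := eqVneq (dot a s`_i) b.
    by rewrite ib lerD2r kmax// ib.
  have bgt : 0 < b - dot a s`_i.
    by rewrite subr_gt0 lt_def eq_sym ib aP//; exact: hull_mem.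
  have : (dot c s`_i - M) / (b - dot a s`_i) <= t.
    rewrite (le_trans (ler_norm _))// /t (bigD1 i)//= lerDl sumr_ge0//.
  rewrite ler_pdivrMr//; lra.
exists M; split.
(* The weight t makes the inequality valid; the extra copy of a forces
   equality in both inequalities when the combined one is tight. *)
- exists (c + (t + 1) *: a), (M + (t + 1) * b); split.
    move=> x hx; have := tP x hx; have := aP x hx.
    rewrite !dotDl !dotZl; lra.
  rewrite GE; apply/seteqP; split => x /=.
    by move=> [[hx ax] cx]; split => //; rewrite dotDl dotZl ax cx.
  move=> [hx]; have := tP x hx; have := aP x hx.
  rewrite !dotDl !dotZl => h1 h2 h3.
  have ax : dot a x = b by lra.
  by do !split => //; rewrite ax in h3; lra.
- by exists s`_k; rewrite GE /=; do !split => //; exact: hull_mem.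
- move=> x; rewrite GE => -[hx ax]; have := tP x hx.
  by rewrite dotDl dotZl ax; lra.
Qed.

(** Maximize the coordinates one after another: each step yields a smaller
    face, and after the last one a single point is left. *)
Lemma face_vertex s G : face (convex_hull s) G -> G !=set0 ->
  exists2 v, vertices (convex_hull s) v & G v.
Proof.
move=> Gf G0.
have agree n : exists H, [/\ face (convex_hull s) H, H !=set0,
    H `<=` G & forall x y, H x -> H y ->
      forall i : 'I_d, (i < n)%N -> x 0 i = y 0 i].
  elim: n => [|k [H [Hf H0 HG Heq]]]; first by exists G; split.
  have [kd|dk] := ltnP k d; last first.
    exists H; split => // x y Hx Hy i _; apply: Heq => //.
    exact: leq_trans (ltn_ord i) dk.
  have [M [Mf M0 _]] := face_argmax s H (delta_mx 0 (Ordinal kd)) Hf H0.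
  eexists; split; [exact: Mf|exact: M0|by move=> x [/HG]|].
  move=> x y [Hx xM] [Hy yM] i; rewrite ltnS leq_eqVlt => /orP[/eqP ik|].
    have -> : i = Ordinal kd by apply/val_inj.
    by rewrite -!dot_delta xM yM.
  exact: Heq.
have [H [Hf [v Hv] HG Heq]] := agree d.
exists v; last exact: HG.
rewrite /vertices /=; suff -> : [set v] = H by [].
apply/seteqP; split => [x /= ->//|x Hx /=].
by apply/rowP => i; apply: Heq.
Qed.
End Hull.

(** * Affine dimension and inclusion of faces *)

Section AffineDim.
Context {R : realType} {d : nat}.
Implicit Types (c x : 'rV[R]_d) (A B : set 'rV[R]_d).

Lemma leq_affine_dim A k x0 (M : 'M[R]_(k, d)) :
  A x0 -> (forall i, A (x0 + row i M)) -> row_free M -> (k <= affine_dim A)%N.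
Proof.
move=> Ax0 AM Mf; have kd : (k < d.+1)%N.
  by rewrite ltnS -(eqP Mf) rank_leq_col.
rewrite /affine_dim.
apply: (@leq_bigmax_cond _ _ (fun k : 'I_d.+1 => k : nat) (Ordinal kd)).
by apply/asboolP; exists x0, M.
Qed.

Lemma affine_dim_attained A : A !=set0 -> exists k x0 (M : 'M[R]_(k, d)),
  [/\ A x0, forall i, A (x0 + row i M), row_free M & affine_dim A = k].
Proof.
move=> [x Ax].
pose p (k : 'I_d.+1) := `[< exists x0 (M : 'M[R]_(k, d)),
  [/\ A x0, forall i, A (x0 + row i M) & row_free M] >].
have p0 : p ord0.
  by apply/asboolP; exists x, 0; split => //; [case|rewrite /row_free mxrank0].
have [|k pk kE] := @eq_bigmax_cond _ p (fun k => k : nat).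
  by apply/card_gt0P; exists ord0.
have /asboolP[x0 [M [? ? ?]]] : p k by [].
by exists k, x0, M.
Qed.

(** The point [x], off the hyperplane containing [A], is affinely independent
    of any independent family in [A]. *)
Lemma affine_dim_lt A B c b x : A !=set0 -> A `<=` B ->
  (forall y, A y -> dot c y = b) -> B x -> dot c x != b ->
  (affine_dim A < affine_dim B)%N.
Proof.
move=> A0 AB Ab Bx xb.
have [k [x0 [M [Ax0 AM Mf ->]]]] := affine_dim_attained A A0.
rewrite -addn1; apply: (leq_affine_dim B _ x0 (col_mx M (x - x0))).
- exact: AB.
- move=> i; case: (splitP i) => j ij.
    have -> : i = lshift 1 j by exact/val_inj.
    by rewrite rowKu; apply: AB.
  have -> : i = rshift _ j by exact/val_inj.
  by rewrite rowKd row_id addrC subrK.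
(* All directions within A are orthogonal to c, while x - x0 is not. *)
have Mc : M *m c^T = 0.
  apply/colP => i; rewrite [RHS]mxE; have := Ab _ (AM i).
  rewrite dotDr (Ab _ Ax0) => /eqP.
  rewrite -subr_eq0 addrAC subrr add0r => /eqP.
  by rewrite dotC /dot -row_mul mxE.
apply: inj_row_free => u; rewrite -[u]hsubmxK mul_row_col => uM.
have u2 : rsubmx u = 0.
  have := congr1 (fun v => v *m c^T) uM.
  rewrite mulmxDl -mulmxA Mc mulmx0 add0r mul0mx -mulmxA => /matrixP /(_ 0 0).
  rewrite [LHS]mxE big_ord1 -/(dot _ _) dotC dotDr dotNr (Ab _ Ax0) [RHS]mxE.
  move=> /eqP; rewrite mulf_eq0 subr_eq0 (negPf xb) orbF => /eqP u0.
  by apply/rowP => i; rewrite ord1 u0 mxE.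
move: uM; rewrite u2 mul0mx addr0 => uM.
have -> : lsubmx u = 0 by apply: (row_free_inj Mf); rewrite uM mul0mx.
exact: row_mx0.
Qed.
End AffineDim.

Section Geometry.
Context {R : realType} {d : nat}.
Implicit Types (s : seq 'rV[R]_d) (P F G : set 'rV[R]_d) (g : 'rV[R]_d -> R).

(** Minimize over [G] the functional [c] that cuts out [F]. The minimum is
    attained on a face, hence at a vertex; this vertex lies in [F], so the
    minimum of [c] over [G] is its maximum over [P]. *)
Lemma face_sub_of_vertices s G F : face (convex_hull s) G ->
  face (convex_hull s) F ->
  (forall v, vertices (convex_hull s) v -> G v -> F v) -> G `<=` F.
Proof.
move=> Gf [c [b [cb ->]]] GF x Gx.
have [M [Mf M0 leM]] := face_argmax s G (- c) Gf (ex_intro _ x Gx).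
have [v vv [Gv cvM]] := face_vertex s _ Mf M0.
have [_ cv] := GF v vv Gv.
have hx := face_sub _ _ Gf x Gx.
split => //; apply/eqP; rewrite eq_le cb//= -lerN2 -dotNl -cv -dotNl cvM.
exact: leM.
Qed.

(** If [G] does not contain [F], then [F `&` G] is a face through the
    minimizers, of smaller dimension by [affine_dim_lt]. *)
Lemma optimal_face_sub P g F G : optimal_face P g F -> face P G ->
  minimizers P g !=set0 -> minimizers P g `<=` G -> F `<=` G.
Proof.
move=> [Ff minF Fmin] Gf [z zmin] minG x Fx.
have Fdim := Fmin _ (faceI _ _ _ Ff Gf)
  (fun y ymin => conj (minF y ymin) (minG y ymin)).
have Px := face_sub _ _ Ff x Fx.
move: Gf Fdim minG => [c [b [_ ->]]] Fdim minG; split => //.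
apply/eqP; apply: contraLR Fdim => xb; rewrite -ltnNge.
apply: (affine_dim_lt _ _ c b x) => //.
- by exists z; split; [exact: minF|exact: minG].
- by move=> y [_ []].
Qed.

Lemma enorm_le_diameter s x y : convex_hull s x -> convex_hull s y ->
  enorm (x - y) <= diameter (convex_hull s).
Proof.
move=> hx hy; have [B hB] := hull_bounded s.
apply: ub_le_sup; last by exists (x, y).
by exists B => _ [[u v] [hu hv] <-]; exact: hB.
Qed.
End Geometry.

(** * First-order conditions *)

Section Deriv.
Context {R : realType} {d : nat}.
Implicit Types (v x y : 'rV[R]_d) (g : 'rV[R]_d -> R).

Lemma cvg_directional g x v : differentiable g x ->
  h^-1 * (g (x + h *: v) - g x) @[h --> 0^'+] --> dot v (grad g x).
Proof.
move=> gx.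
have <- : 'D_v g x = dot v (grad g x).
  rewrite deriveE// [in LHS](row_sum_delta v) linear_sum dotE.
  by apply: eq_bigr => i _; rewrite linearZ mxE deriveE.
apply: cvg_dnbhs_at_right.
have : derivable g x v by exact: diff_derivable.
rewrite /derivable /derive.
rewrite (_ : (fun h : R => _) = (fun h => h^-1 * (g (x + h *: v) - g x))) //.
by apply/funext => h; rewrite /= (addrC x).
Qed.

Lemma grad_le g x v m : differentiable g x ->
  (forall h, 0 < h <= 1 -> g (x + h *: v) - g x <= h * m) ->
  dot v (grad g x) <= m.
Proof.
move=> gx gm; apply: (cvgr_to_le (cvg_directional _ _ v gx)).
near=> h; have h0 : 0 < h by near: h; exact: nbhs_right_gt.
rewrite ler_pdivrMl//; apply: gm; rewrite h0/=.
by near: h; apply: nbhs_right_le.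
Unshelve. all: by end_near. Qed.

Lemma grad_ge g x v m : differentiable g x ->
  (forall h, 0 < h <= 1 -> h * m <= g (x + h *: v) - g x) ->
  m <= dot v (grad g x).
Proof.
move=> gx gm; apply: (cvgr_to_ge (cvg_directional _ _ v gx)).
near=> h; have h0 : 0 < h by near: h; exact: nbhs_right_gt.
rewrite ler_pdivlMl//; apply: gm; rewrite h0/=.
by near: h; apply: nbhs_right_le.
Unshelve. all: by end_near. Qed.

(** The chord above the graph, compared with the tangent at [x]. *)
Lemma convex_grad_le g x y : differentiable g x ->
  convex_function [set: 'rV[R]_d] g -> dot (y - x) (grad g x) <= g y - g x.
Proof.
move=> gx gc; apply: grad_le => // h /andP[h0 h1].
have : g (h *: y + (1 - h) *: x) <= h * g y + (1 - h) * g x.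
  by apply: (gc (Itv01 (ltW h0) h1)); rewrite inE.
rewrite (_ : h *: y + (1 - h) *: x = x + h *: (y - x)); last first.
  by apply/rowP => k; rewrite !mxE; ring.
lra.
Qed.

Lemma minimizer_grad_ge0 s g x y : differentiable g x ->
  minimizers (convex_hull s) g x -> convex_hull s y ->
  0 <= dot (y - x) (grad g x).
Proof.
move=> gx [hx gmin] hy; apply: grad_ge => // h /andP[h0 h1].
rewrite mulr0 subr_ge0; apply: gmin; apply: hull_convex => //.
by rewrite (ltW h0).
Qed.
End Deriv.

(** * Existence of minimizers *)

Section Compact.
Context {R : realType} {d : nat}.

(** A polytope is the continuous image of the standard simplex, a closed part
    of a cube. *)
Lemma hull_compact (s : seq 'rV[R]_d) : compact (convex_hull s).
Proof.
set n := size s.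
pose box : set 'rV[R]_n := [set w | forall i, `[0, 1]%classic (w 0 i)].
pose slice : set 'rV[R]_n := (fun w => \sum_i w 0 i) @^-1` [set 1].
pose simplex := box `&` slice.
pose phi (w : 'rV[R]_n) := \sum_i w 0 i *: s`_i.
have -> : convex_hull s = phi @` simplex.
  apply/seteqP; split => [x [w [w0 w1 ->]]|_ [w [w01 w1] <-]].
    exists (\row_i w i); last by apply: eq_bigr => i _; rewrite mxE.
    have sw : \sum_i (\row_i w i : 'rV_n) 0 i = 1.
      by rewrite -[RHS]w1; apply: eq_bigr => i _; rewrite mxE.
    split => // i; rewrite /= in_itv/= mxE w0 -w1 (bigD1 i)//= lerDl.
    exact: sumr_ge0.
  exists (fun i => w 0 i); split => // i.
  by have := w01 i; rewrite /= in_itv/= => /andP[].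
apply: continuous_compact.
  apply: continuous_subspaceT => w; apply: differentiable_continuous.
  rewrite (_ : phi = \sum_i (fun w : 'rV[R]_n => w 0 i *: s`_i)).
    apply: differentiable_sum => i; apply: differentiableZl.
    exact: differentiable_coord.
  by apply/funext => v; rewrite fct_sumE.
apply: compact_closedI.
  apply: (@rV_compact R n (fun=> `[0, 1]%classic)) => i.
  exact: segment_compact.
apply: closed_comp; last exact: closed_eq.
move=> w _; apply: differentiable_continuous.
rewrite (_ : (fun w : 'rV[R]_n => _) = \sum_i (fun w : 'rV[R]_n => w 0 i)).
  by apply: differentiable_sum => i; exact: differentiable_coord.
by apply/funext => v; rewrite fct_sumE.
Qed.

Lemma minimizer_exists (s : seq 'rV[R]_d) g : convex_hull s !=set0 ->
  (forall x, differentiable g x) -> minimizers (convex_hull s) g !=set0.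
Proof.
move=> s0 gd; have [|c] := @EVT_min_rV R d g _ s0 (hull_compact s).
  by apply: continuous_subspaceT => w; exact: differentiable_continuous.
rewrite inE => cs cmin; exists c; split => // y ys.
by apply: cmin; rewrite inE.
Qed.
End Compact.

(** * Perturbing the objective *)

Section Perturbation.
Context {R : realType} {d : nat}.
Implicit Types (s : seq 'rV[R]_d) (P F G : set 'rV[R]_d) (f g : 'rV[R]_d -> R).

Lemma minval_minimizer P g y : minimizers P g y -> minval P g = g y.
Proof.
move=> [Py ymin]; apply/eqP; rewrite eq_le; apply/andP; split.
  by apply: ge_inf; [exists (g y) => _ [z Pz <-]; exact: ymin|exists y].
by apply: lb_le_inf; [exists (g y); exists y|move=> _ [z Pz <-]; exact: ymin].
Qed.

(** Write r for the distance from [x] to the minimizers. Growth and the linear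
    bound on the gap give alpha r^2 <= 2 nu |x - y| for all of them, hence
    alpha r^2 <= 2 nu r. Since [t] exceeds [2 * nu / alpha], a minimizer that
    nearly attains the distance r will do. *)
Lemma growth_near_minimizer P g alpha nu t x : 0 < alpha -> 0 <= nu ->
  quadratic_growth alpha P g -> minimizers P g !=set0 -> P x ->
  (forall y, minimizers P g y -> g x - g y <= nu * enorm (x - y)) ->
  2 * nu / alpha < t ->
  exists2 y, minimizers P g y & enorm (x - y) < t.
Proof.
move=> a0 nu0 growth [y0 y0min] Px gap lt_t.
pose E := [set enorm (y - x) | y in minimizers P g].
have E0 : E !=set0 by exists (enorm (y0 - x)); exists y0.
have Elb : lbound E 0 by move=> _ [y _ <-]; exact: enorm_ge0.
have r0 : 0 <= inf E by exact: lb_le_inf.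
have rE e : E e -> alpha * inf E ^+ 2 <= 2 * nu * e.
  have gr : inf E ^+ 2 <= 2 / alpha * (g x - minval P g) := growth x Px.
  move=> [y ymin <-]; have := gap y ymin; move: gr; rewrite (enormC x).
  by rewrite (minval_minimizer _ _ _ ymin) mulrAC ler_pdivlMr//; lra.
have rle : inf E <= 2 * nu / alpha.
  rewrite ler_pdivlMr// mulrC.
  have [nuE|nune0] := eqVneq nu 0.
    by have [e Ee] := E0; have := rE e Ee; rewrite nuE; nra.
  have nugt : 0 < 2 * nu by rewrite mulr_gt0// lt_def nune0.
  have : alpha * inf E ^+ 2 / (2 * nu) <= inf E.
    by apply: lb_le_inf => // e Ee; rewrite ler_pdivrMr// [e * _]mulrC rE.
  rewrite ler_pdivrMr// => h.
  have [->|rne0] := eqVneq (inf E) 0; first by rewrite mulr0 ltW.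
  have rgt : 0 < inf E by rewrite lt_def rne0.
  by rewrite -(ler_pM2l rgt); nra.
have infE : has_inf E by split => //; exists 0.
have [|_ [y ymin <-] ylt] := @inf_adherent R E (t - inf E) _ infE.
  by rewrite subr_gt0 (le_lt_trans rle).
by exists y => //; rewrite enormC; lra.
Qed.

(** With a minimizer [y] of [f] near [x],
    <v - x, grad g x> = <v - y, grad f y> + <v - y, grad g x - grad f x>
                        + <v - y, grad f x - grad f y> + <y - x, grad g x>,
    where the first term is at least [delta], the next two are at least
    [- D * nu] and [- D * beta * |x - y|], and the last is nonnegative. *)
Lemma vertex_gap s f g F alpha beta nu delta x v :
  let P := convex_hull s in let D := diameter P in
  0 < alpha -> 0 <= beta -> 0 <= D -> smooth beta f ->
  (forall z, differentiable g z) ->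
  convex_function [set: 'rV[R]_d] f -> quadratic_growth alpha P f ->
  (forall z, P z -> enorm (grad f z - grad g z) <= nu) ->
  strict_complementarity delta P f F ->
  nu * (D * (1 + 2 * beta / alpha)) < delta ->
  minimizers P g x -> vertices P v -> ~ F v ->
  0 < dot (v - x) (grad g x).
Proof.
move=> P D a0 b0 D0 [fd fL] gd fc growth close compl small xmin vv nFv.
have Px : P x by case: xmin.
have Pv : P v by exact: face_sub vv v erefl.
have nu0 : 0 <= nu := le_trans (enorm_ge0 _) (close x Px).
have gap y : minimizers P f y -> f x - f y <= nu * enorm (x - y).
  move=> [Py _].
  have := convex_grad_le f x y (fd x) fc.
  have := minimizer_grad_ge0 s g x y (gd x) xmin Py.
  have := cauchy_schwarz (y - x) (grad g x - grad f x).
  have := ler_wpM2l (enorm_ge0 (y - x)) (close x Px).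
  rewrite (enormC (grad f x)) (enormC x y) (dotDr _ (grad g x)) dotNr; lra.
pose kappa := delta - nu * (D * (1 + 2 * beta / alpha)).
have k0 : 0 < kappa by rewrite subr_gt0.
(* eps is a distance beyond 2 nu / alpha whose cost D beta eps is still
   below the margin kappa left by the bound on nu. *)
pose eps := kappa / (D * beta + 1).
have Db : 0 < D * beta + 1 by rewrite ltr_wpDl// mulr_ge0.
have eps0 : 0 < eps by rewrite divr_gt0.
have epsk : D * beta * eps < kappa.
  by rewrite /eps mulrCA gtr_pMr// ltr_pdivrMr// mul1r ltrDl.
have min0 : minimizers P f !=set0 by apply: minimizer_exists => //; exists x.
have [|y ymin yt] := growth_near_minimizer P f alpha nu (2 * nu / alpha + eps) x
    a0 nu0 growth min0 Px gap; first by rewrite ltrDl.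
have Py : P y by case: ymin.
have vyD := enorm_le_diameter s v y Pv Py.
have := (compl y v ymin vv).1 nFv.
have := minimizer_grad_ge0 s g x y (gd x) xmin Py.
have := dot_ge_Nenorm (v - y) (grad g x - grad f x).
have := dot_ge_Nenorm (v - y) (grad f x - grad f y).
have h1 : enorm (v - y) * enorm (grad g x - grad f x) <= D * nu.
  by rewrite ler_pM ?enorm_ge0// enormC close.
have h2 : enorm (v - y) * enorm (grad f x - grad f y) <=
    D * (beta * (2 * nu / alpha + eps)).
  rewrite ler_pM ?enorm_ge0// (le_trans (fL x y))// ler_wpM2l//; exact: ltW.
have h3 : D * nu + D * (beta * (2 * nu / alpha + eps)) < delta.
  rewrite -subr_gt0 (_ : _ - _ = kappa - D * beta * eps) ?subr_gt0//.
  by rewrite /kappa; ring.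
rewrite !dot_expand; lra.
Qed.
End Perturbation.

Theorem theorem3 (R : realType) (d : nat) (P : set 'rV[R]_d)
    (f ft : 'rV[R]_d -> R) (F Ft : set 'rV[R]_d)
    (D alpha beta nu delta : R)
    (P_polytope : polytope P)
    (D_diam : D = diameter P)
    (f_smooth : smooth beta f) (ft_smooth : smooth beta ft)
    (f_convex : convex_function [set: 'rV[R]_d] f)
    (ft_convex : convex_function [set: 'rV[R]_d] ft)
    (alpha_gt0 : 0 < alpha)
    (f_growth : quadratic_growth alpha P f)
    (ft_growth : quadratic_growth alpha P ft)
    (grad_close : forall x, P x -> enorm (grad f x - grad ft x) <= nu)
    (F_optimal : optimal_face P f F)
    (Ft_optimal : optimal_face P ft Ft)
    (delta_gt0 : 0 < delta)
    (f_compl : strict_complementarity delta P f F)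
    (nu_small : (nu%:E < delta%:E / (D * (1 + 2 * beta / alpha))%:E)%E) :
  Ft `<=` F.
Proof.
have [s PE] := P_polytope; subst P D.
set P := convex_hull s in f_growth ft_growth grad_close F_optimal Ft_optimal
  f_compl nu_small *.
have [Ff minF _] := F_optimal; have [Ftf _ _] := Ft_optimal.
have ftd := ft_smooth.1.
move=> z Ftz; apply: contrapT => nFz.
have Pz : P z by exact: face_sub Ftf z Ftz.
have P0 : P !=set0 by exists z.
have [y0 y0min] := minimizer_exists s f P0 f_smooth.1.
have zy : 0 < enorm (z - y0).
  rewrite lt_def enorm_ge0 andbT; apply/eqP => /enorm_eq0 /eqP.
  by rewrite subr_eq0 => /eqP zy; apply: nFz; rewrite zy; exact: minF.
have D0 : 0 < diameter P.
  by apply: lt_le_trans zy _; apply: enorm_le_diameter => //; case: y0min.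
have b0 : 0 <= beta.
  by rewrite -(pmulr_lge0 _ zy) (le_trans _ (f_smooth.2 z y0))// enorm_ge0.
have c0 : 0 < diameter P * (1 + 2 * beta / alpha).
  by rewrite mulr_gt0// ltr_wpDr// divr_ge0 ?mulr_ge0// ltW.
have small : nu * (diameter P * (1 + 2 * beta / alpha)) < delta.
  move: nu_small; rewrite inver (gt_eqF c0) -EFinM lte_fin.
  by rewrite ltr_pdivlMr.
apply: nFz; apply: (optimal_face_sub _ _ _ _ Ft_optimal Ff) Ftz.
  exact: minimizer_exists.
move=> x xmin; have Px : P x by case: xmin.
set q := grad ft x.
have qmin y : P y -> 0 <= dot (y - x) q by exact: minimizer_grad_ge0.
(* The face where the linear functional q is minimal over P. *)
pose Z := [set y | P y /\ dot (- q) y = - dot q x].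
have Zf : face P Z.
  exists (- q), (- dot q x); split => // y Py.
  by have := qmin y Py; rewrite !dot_expand !(dotC _ q); lra.
apply: (face_sub_of_vertices s Z F Zf Ff); last by rewrite /Z /= dotNl.
move=> v vv [_]; rewrite dotNl => /oppr_inj qv; apply: contrapT => nFv.
have := vertex_gap s f ft F alpha beta nu delta x v alpha_gt0 b0 (ltW D0)
  f_smooth ftd f_convex f_growth grad_close f_compl small xmin vv nFv.
by rewrite -/q dotDl dotNl !(dotC _ q) qv subrr ltxx.
Qed.
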